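(* Let $\mathbb F_q$ be a finite field. Every subgroup of $\mathrm{AGL}(1,\mathbb F_q)$ is of the form $S(a,b,H)$ for some $(a,b,H)\in\mathcal S$.
   Context: $\mathrm{AGL}(1,\mathbb F_q)=\left\{\left[\begin{smallmatrix}a&b\\0&1\end{smallmatrix}\right]:a\in\mathbb F_q^*,\ b\in\mathbb F_q\right\}<\mathrm{GL}(2,\mathbb F_q)$, and $p=\mathrm{char}\,\mathbb F_q$. $\mathcal S$ is the set of triples $(a,b,H)$ with $a\in\mathbb F_q^*$, $H$ an $\mathbb F_p(a)$-subspace of $\mathbb F_q$, and $b=0$ if $a=1$, $b\in\mathbb F_q$ if $a\ne1$. Let $\overline H=\left\{\left[\begin{smallmatrix}1&h\\0&1\end{smallmatrix}\right]:h\in H\right\}$ and let $S(a,b,H)$ be the subgroup of $\mathrm{AGL}(1,\mathbb F_q)$ generated by $\left[\begin{smallmatrix}a&b\\0&1\end{smallmatrix}\right]$ and $\overline H$. *)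

(* Defs.v *)
From HB Require Import structures.
From mathcomp Require Import all_boot all_order all_algebra all_fingroup all_field.

Set Implicit Arguments.
Unset Strict Implicit.
Unset Printing Implicit Defensive.

Import GRing.Theory.
Local Open Scope ring_scope.

Section AGL1.
Variable F : finFieldType.
Implicit Types (a : {unit F}) (b : F) (H : {set F}).

Definition aff_mx (a b : F) : 'M[F]_2 :=
  \matrix_(i, j) (if i == 0 then (if j == 0 then a else b)
                  else (if j == 0 then 0 else 1)).

Lemma aff_mx_unit a b : aff_mx (val a) b \is a GRing.unit.
Proof.
rewrite -[_ \is a _]/(_ \in unitmx) unitmxE (expand_det_col _ ord0).
rewrite big_ord_recl big_ord1 /cofactor !det_mx11 !mxE /=.
rewrite mul0r addr0 expr0 mul1r mulr1.
exact: valP a.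
Qed.

Definition aff a b : {'GL_2[F]} := FinRing.unit 'M[F]_2 (aff_mx_unit a b).

Definition AGL1 : {set {'GL_2[F]}} := [set aff a b | a : {unit F}, b : F].

Lemma aff_mxM (a b c d : F) :
  aff_mx a b *m aff_mx c d = aff_mx (a * c) (a * d + b).
Proof.
apply/matrixP=> i j; rewrite !mxE big_ord_recl big_ord1 !mxE /=.
case: (i == 0); case: (j == 0);
  by rewrite ?mulr0 ?mul0r ?mulr1 ?mul1r ?addr0 ?add0r.
Qed.

Lemma AGL1_group_set : group_set AGL1.
Proof.
apply/group_setP; split=> [|_ _ /imset2P[a b _ _ ->] /imset2P[c d _ _ ->]].
  apply/imset2P; exists (1%g : {unit F}) (0 : F) => //; apply: val_inj.
  apply/matrixP=> i j; rewrite !mxE.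
  by case: i => [[|[|i]] Hi]; case: j => [[|[|j]] Hj].
apply/imset2P; exists (a * c)%g (val a * d + b) => //; apply: val_inj.
exact: aff_mxM.
Qed.

Canonical AGL1_group := Group AGL1_group_set.

Definition unipotent H : {set {'GL_2[F]}} := [set aff 1%g h | h in H].

Definition AGL1_sub a b H : {group {'GL_2[F]}} :=
  <<aff a b |: unipotent H>>%G.

Variables (p : nat) (pcharFp : p \in [pchar F]).

(* F_p(a); [pPrimeCharType pcharFp] is F seen as an extension of 'F_p. *)
Definition Fp_adjoin (a : F) : {subfield pPrimeCharType pcharFp} :=
  <<1; (a : pPrimeCharType pcharFp)>>%AS.

(* [fieldOver (Fp_adjoin a)] is F seen as a vector space over F_p(a). *)
Definition is_Fp_adjoin_subspace (a : F) H : Prop :=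
  exists V : {vspace fieldOver (Fp_adjoin a)},
    forall h : F, (h \in H) = ((h : fieldOver (Fp_adjoin a)) \in V).

Definition AGL1_triple a b H : Prop :=
  is_Fp_adjoin_subspace (val a) H /\ (val a = 1 -> b = 0).

End AGL1.

(* Main.v *)
Require Import Defs.
From mathcomp Require Import all_boot all_order all_algebra all_fingroup all_field.
From mathcomp Require Import cyclic.

(** Let [T] be the group of translation parts [h] of the unipotent elements
    [aff 1 h] of [G], and [D] the group of multipliers [a] of the elements
    [aff a b] of [G].  As a finite group of units of a field, [D] is cyclic;
    let [a] generate it and choose [aff a b] in [G].  For [g] in [G] some power
    of [aff a b] has the same multiplier as [g], hence agrees with [g] up to a
    translation by an element of [T]: thus [aff a b] and [T] generate [G].

    [T] is an additive group, and conjugating [aff 1 h] by [aff a b] yields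
    [aff 1 (a * h)], so [T] is stable under multiplication by [a].  Every
    element of F_p(a) is a polynomial in [a] whose coefficients are multiples
    of 1, so [T] is stable under F_p(a): it is an F_p(a)-subspace
    ([Fp_adjoin_subspace_of_mul_closed]).  When [a = 1] the choice [b = 0] is possible
    because [G] contains the identity [aff 1 0]. *)

Section Subgroups.
Set Implicit Arguments.
Unset Strict Implicit.
Import GRing.Theory.
Local Open Scope ring_scope.

Variable F : finFieldType.
Implicit Types (a c : {unit F}) (b d h : F).

Section Subspaces.
Variables (p : nat) (pcharFp : p \in [pchar F]) (a : F) (H : {set F}).
Hypotheses (H0 : 0 \in H) (HD : {in H &, forall x y, x + y \in H}).
Hypothesis HM : {in H, forall x, a * x \in H}.

Lemma sum_closed (I : Type) (r : seq I) (f : I -> F) :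
  (forall i, f i \in H) -> \sum_(i <- r) f i \in H.
Proof. by move=> Hf; apply: (big_ind (fun x => x \in H)). Qed.

(** [c] is a polynomial in [a] whose coefficients are multiples of 1: the
    powers of [a] preserve [H] by [HM], and the multiples of 1 by [HD]. *)
Lemma Fp_adjoin_mul_closed (c : pPrimeCharType pcharFp) :
  c \in Fp_adjoin pcharFp a -> {in H, forall h, (c : F) * h \in H}.
Proof.
move=> /Fadjoin_polyP[q /polyOverP q1 ->] h hH.
rewrite horner_coef mulr_suml; apply: sum_closed => i.
have [k ->] := vlineP _ _ (q1 i).
have -> : k *: (1 : pPrimeCharType pcharFp) = (k%:R : F).
  (* The scaling by 'F_p is by definition multiplication by k%:R. *)
  exact: mulr1.
rewrite -mulrA mulr_natl.
have aiH : (a : F) ^+ i * h \in H.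
  elim: (nat_of_ord i) => [|n IH]; first by rewrite mul1r.
  by rewrite exprS -mulrA; apply: HM.
elim: (nat_of_ord k) => [|n IH]; first by rewrite mulr0n.
by rewrite mulrS; apply: HD.
Qed.

(** The F_p(a)-span of the elements of [H] serves as the subspace: [H] is stable
    under F_p(a)-linear combinations, so the span adds nothing to it. *)
Lemma Fp_adjoin_subspace_of_mul_closed : is_Fp_adjoin_subspace pcharFp a H.
Proof.
pose K := Fp_adjoin pcharFp a.
exists <<(enum H : seq (fieldOver K))>>%VS => h.
apply/idP/idP=> [hH | hV]; first by apply: memv_span; rewrite mem_enum.
rewrite [h](coord_span (X := in_tuple (enum H : seq (fieldOver K))) hV).
apply: sum_closed => i; rewrite fieldOver_scaleE.
apply: Fp_adjoin_mul_closed; first exact: subvsP.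
by rewrite -mem_enum; apply: mem_nth.
Qed.

End Subspaces.

Lemma affM a b c d : (aff a b * aff c d)%g = aff (a * c)%g (val a * d + b).
Proof. by apply: val_inj; apply: aff_mxM. Qed.

Lemma aff10 : aff (1%g : {unit F}) 0 = 1%g.
Proof.
apply: val_inj; apply/matrixP=> i j; rewrite !mxE.
by case: i => [[|[|i]] Hi]; case: j => [[|[|j]] Hj].
Qed.

Lemma affX a b n : exists d, (aff a b ^+ n)%g = aff (a ^+ n)%g d.
Proof.
elim: n => [|n [d IH]]; first by exists 0; rewrite !expg0 aff10.
by exists (val a * d + b); rewrite !expgS IH affM.
Qed.

Lemma aff_translate a b h : aff a (h + b) = (aff 1%g h * aff a b)%g.
Proof. by rewrite affM mul1g mul1r addrC. Qed.

(** Conjugation by [aff a b] scales translations by [a]; in this form no inverse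
    has to be computed. *)
Lemma aff_conj_translation a b h :
  (aff a b * aff 1%g h)%g = (aff 1%g (val a * h)%R * aff a b)%g.
Proof. by rewrite -aff_translate affM mulg1. Qed.

Variable G : {group {'GL_2[F]}}.

Definition translations : {set F} := [set h | aff 1%g h \in G].

Definition multipliers : {set {unit F}} :=
  [set a | [exists b, aff a b \in G]].

Lemma multipliersP a : reflect (exists b, aff a b \in G) (a \in multipliers).
Proof. by rewrite inE; apply: existsP. Qed.

Lemma multipliers_group_set : group_set multipliers.
Proof.
apply/group_setP; split; first by apply/multipliersP; exists 0; rewrite aff10.
move=> a c /multipliersP[b Gab] /multipliersP[d Gcd]; apply/multipliersP.
by exists (val a * d + b); rewrite -affM groupM.
Qed.

Lemma multipliers_generator : exists a, multipliers = <[a]>%g.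
Proof.
exact/cyclicP/(field_unit_group_cyclic (Group multipliers_group_set)).
Qed.

Lemma translations0 : 0 \in translations.
Proof. by rewrite inE aff10. Qed.

Lemma translationsD :
  {in translations &, forall h1 h2, h1 + h2 \in translations}.
Proof. by move=> h1 h2; rewrite !inE aff_translate => *; apply: groupM. Qed.

Lemma translationsM a b :
  aff a b \in G -> {in translations, forall h, val a * h \in translations}.
Proof.
move=> Gab h; rewrite !inE => Gh.
by rewrite -(groupMr _ Gab) -aff_conj_translation groupM.
Qed.

(** Dividing an element of [G] by the power of [aff a b] with the same
    multiplier leaves a translation. *)
Lemma AGL1_sub_translations a b :
  G \subset AGL1 F -> multipliers = <[a]>%g -> aff a b \in G ->
  G = AGL1_sub a b translations.
Proof.
move=> sGA defD Gab; apply/group_inj/eqP; rewrite eqEsubset.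
apply/andP; split; last first.
  rewrite gen_subG subUset sub1set Gab /=.
  by apply/subsetP=> _ /imsetP[h + ->]; rewrite inE.
apply/subsetP=> g Gg; have /imset2P[c d _ _ def_g] := subsetP sGA g Gg.
have /cycleP[n def_c] : c \in <[a]>%g.
  by rewrite -defD; apply/multipliersP; exists d; rewrite -def_g.
have [e def_abn] := affX a b n.
have Sab : aff a b \in AGL1_sub a b translations.
  by apply: mem_gen; rewrite setU11.
have {}def_g : g = (aff 1%g (d - e)%R * aff a b ^+ n)%g.
  by rewrite def_abn -aff_translate subrK -def_c.
rewrite def_g groupM ?groupX //; apply: mem_gen; apply/setUP; right.
by apply: imset_f; rewrite inE -(groupMr _ (groupX n Gab)) -def_g.
Qed.

End Subgroups.

Theorem theorem3p1 (F : finFieldType) (p : nat) (pcharFp : p \in [pchar F]%R)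
    (G : {group {'GL_2[F]}}) (sGA : G \subset AGL1 F) :
  exists (a : {unit F}) (b : F) (H : {set F}),
    AGL1_triple pcharFp a b H /\ G = AGL1_sub a b H.
Proof.
have [a defD] := multipliers_generator G.
have [b Gab b_a1] : exists2 b, aff a b \in G & (val a = 1 -> b = 0)%R.
  have /multipliersP[b Gab] : a \in multipliers G by rewrite defD cycle_id.
  have [a1 | /eqP a_neq1] := eqVneq (val a) 1%R; last by exists b.
  exists 0%R => //.
  have -> : a = 1%g by apply: val_inj.
  by rewrite aff10.
exists a, b, (translations G); split; last exact: AGL1_sub_translations.
split=> //; apply: Fp_adjoin_subspace_of_mul_closed.
- exact: translations0.
- exact: translationsD.
- exact: (translationsM Gab).
Qed.
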